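(* Let $\Gamma$ be a nonabelian free group of (finite) rank $m$ with finite generating set $X$. Then $n^{1/3}\preceq \mathrm{F}_{\Gamma,X}(n)$.
   Context: $\|\cdot\|_X$ denotes word length with respect to $X$. $\mathrm{F}_{\Gamma,X}(n)$ is the smallest positive integer $N$ such that for every nontrivial $\gamma\in\Gamma$ with $\|\gamma\|_X\le n$ there is a normal subgroup of $\Gamma$ of finite index at most $N$ not containing $\gamma$. For functions $f_1,f_2$ on the positive integers with values in $[0,\infty]$, $f_1\preceq f_2$ means that there is a constant $C$ (a positive integer) such that $f_1(n)\le C f_2(Cn)$ for all $n\geq 1$. *)

(* Defs.v *)
From HB Require Import structures.
From mathcomp Require Import all_boot all_order all_algebra.
From mathcomp Require Import all_fingroup.
From mathcomp Require Import all_classical all_reals all_analysis.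

Set Implicit Arguments.
Unset Strict Implicit.
Unset Printing Implicit Defensive.

Import Order.TTheory GRing.Theory Num.Theory.

Local Open Scope classical_set_scope.
Local Open Scope card_scope.

Section Groups.
Local Open Scope group_scope.

Definition is_subgroup (G : groupType) (H : set G) : Prop :=
  [/\ H 1,
      forall x y, H x -> H y -> H (x * y)
    & forall x, H x -> H x^-1].

Definition is_normal_subgroup (G : groupType) (H : set G) : Prop :=
  is_subgroup H /\ forall x g, H x -> H (g^-1 * x * g).

Definition left_cosets (G : groupType) (H : set G) : set (set G) :=
  range (fun g : G => [set g * h | h in H]).

(* The index of H is finite and at most N. *)
Definition index_le (G : groupType) (H : set G) (N : nat) : Prop :=
  left_cosets H #<= `I_N.

Definition generates (G : groupType) (X : set G) : Prop :=
  forall H : set G, is_subgroup H -> X `<=` H -> H = setT.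

Definition is_group_hom (G H : groupType) (f : G -> H) : Prop :=
  {morph f : x y / x * y}.

Definition free_basis (G : groupType) (I : Type) (b : I -> G) : Prop :=
  forall (H : groupType) (phi : I -> H),
    exists f : G -> H,
      [/\ is_group_hom f, forall i, f (b i) = phi i
        & forall f' : G -> H,
            is_group_hom f' -> (forall i, f' (b i) = phi i) -> f' =1 f].

Definition is_free_of_rank (G : groupType) (m : nat) : Prop :=
  exists b : 'I_m -> G, free_basis b.

Definition is_abelian (G : groupType) : Prop := forall x y : G, x * y = y * x.

Definition is_word_product (G : groupType) (X : set G) (g : G) (k : nat) :
    Prop :=
  exists w : seq G,
    [/\ size w = k,
        forall x, x \in w -> X x \/ X x^-1
      & g = \prod_(x <- w) x].

End Groups.

Local Open Scope ring_scope.
Local Open Scope ereal_scope.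

(* The smallest natural number satisfying P, and +oo if there is none. *)
Definition least (R : realType) (P : nat -> Prop) : \bar R :=
  if pselect (exists n, `[< P n >]) is left exP then (ex_minn exP)%:R%:E
  else +oo.

Definition word_length (R : realType) (G : groupType) (X : set G) (g : G) :
    \bar R :=
  least R (is_word_product X g).

Definition residual_growth (R : realType) (G : groupType) (X : set G)
    (n : nat) : \bar R :=
  least R (fun N : nat =>
    (0 < N)%N /\
    forall g : G, g <> 1%g -> word_length R X g <= n%:R%:E ->
      exists H : set G, [/\ is_normal_subgroup H, index_le H N & ~ H g]).

(* Only the values of f1 and f2 at positive integers matter. *)
Definition preceq (R : realType) (f1 f2 : nat -> \bar R) : Prop :=
  exists C : nat, (0 < C)%N /\
    forall n : nat, (1 <= n)%N -> f1 n <= C%:R%:E * f2 (C * n)%N.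

(* Main.v *)
Require Import Defs.
From HB Require Import structures.
From mathcomp Require Import all_boot all_order all_algebra all_fingroup.
From mathcomp Require Import all_classical all_reals all_analysis.
From mathcomp Require Import zify.

Set Implicit Arguments.
Unset Strict Implicit.
Unset Printing Implicit Defensive.

Import Order.TTheory GRing.Theory Num.Theory.

Local Open Scope classical_set_scope.
Local Open Scope ring_scope.

(** In a group of order at most [N] every element [a] satisfies [a ^+ i = 1]
for some [1 <= i <= N].  A balanced binary tree of commutators whose leaves are
[a], [a ^+ 2], ..., [a ^+ (2 ^ d)] with [N <= 2 ^ d <= 2 N] therefore dies in
every quotient of order at most [N].  A commutator multiplies length by four
and the leaves have length at most [2 ^ d], so the word has length
[O (8 ^ d) = O (N ^ 3)].  Twisting the commutators by a second free generator
[b] keeps the words reduced; that they are nontrivial is checked by letting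
[a] and [b] play ping-pong on [int * int]. *)

(** * Commutator trees and normal subgroups of small index *)

Section CommutatorTree.
Local Open Scope group_scope.

(** The leaves are the powers of [a] with exponents from [s + 1] to [s + 2 ^ d]. The outer
    conjugation by [a] makes the reduced word end in [a] again, as the next level requires. *)
Fixpoint comm_tree (G : groupType) (a b : G) (d s : nat) : G :=
  if d is d'.+1 then
    [~ comm_tree a b d' s, comm_tree a b d' (s + 2 ^ d') ^ b] ^ a
  else a ^+ s.+1.

Lemma hom1 (G H : groupType) (f : G -> H) : is_group_hom f -> f 1 = 1.
Proof. by move=> fM; apply: (@mulgI _ (f 1)); rewrite -fM !mulg1. Qed.

Lemma homV (G H : groupType) (f : G -> H) :
  is_group_hom f -> {morph f : x / x^-1}.
Proof.
by move=> fM x; apply: (@mulgI _ (f x)); rewrite -fM !mulgV hom1.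
Qed.

Lemma hom_comm_tree (G H : groupType) (f : G -> H) (a b : G) d s :
  is_group_hom f -> f (comm_tree a b d s) = comm_tree (f a) (f b) d s.
Proof.
move=> fM; elim: d s => [|d IH] s /=.
  by elim: s => [|s IHs]; rewrite ?expg1 // expgS fM IHs -expgS.
by rewrite /commg /conjg !(fM, homV fM) !IH.
Qed.

Lemma normal_conj (G : groupType) (H : set G) (x g : G) :
  is_normal_subgroup H -> H x -> H (x ^ g).
Proof. by move=> [_ HJ] Hx; rewrite /conjg mulgA; apply: HJ. Qed.

Lemma normal_comml (G : groupType) (H : set G) (x y : G) :
  is_normal_subgroup H -> H x -> H [~ x, y].
Proof.
move=> nH Hx; have [[_ HM HV] _] := nH.
by rewrite /commg; apply: HM; [exact: HV | exact: normal_conj].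
Qed.

Lemma normal_commr (G : groupType) (H : set G) (x y : G) :
  is_normal_subgroup H -> H y -> H [~ x, y].
Proof.
move=> nH Hy; have [[_ _ HV] _] := nH.
by rewrite -invgR; apply: HV; exact: normal_comml.
Qed.

(** The leaf [a ^+ i] sits in one half of the tree, and a commutator with one entry in a normal
    subgroup lies in that subgroup. *)
Lemma comm_tree_normal (G : groupType) (H : set G) (a b : G) d s i :
  is_normal_subgroup H -> (s < i <= s + 2 ^ d)%N -> H (a ^+ i) ->
  H (comm_tree a b d s).
Proof.
move=> nH + Hi; elim: d s => [|d IH] s /= si.
  by have -> : s.+1 = i by lia.
apply: normal_conj => //; rewrite expnS in si.
have [le_i|lt_i] := leqP i (s + 2 ^ d).
  by apply: normal_comml => //; apply: IH; lia.
by apply: normal_commr => //; apply: normal_conj => //; apply: IH; lia.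
Qed.

(** Pigeonhole: the [N + 1] cosets of [a ^+ 0], ..., [a ^+ N] cannot be distinct, and two equal ones
    give the exponent [j - i]. *)
Lemma index_le_pow (G : groupType) (H : set G) (N : nat) (a : G) :
  is_subgroup H -> index_le H N -> exists2 i, (0 < i <= N)%N & H (a ^+ i).
Proof.
move=> [H1 HM HV] HN; pose coset (i : nat) := [set a ^+ i * h | h in H].
have [inj_coset|] := pselect ({in `I_N.+1 &, injective coset}).
  have le_cosets : (`I_N.+1 #<= left_cosets H)%card.
    have /card_eqPle[_ le_coset] := inj_card_eq inj_coset.
    apply: card_le_trans le_coset (subset_card_le _).
    by move=> _ [i _ <-]; exists (a ^+ i).
  by have := card_le_trans le_cosets HN; rewrite card_le_II ltnn.
move/existsNP => [i] /existsNP [j] /not_implyP[/set_mem /= iN].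
move=> /not_implyP[/set_mem /= jN] /not_implyP[eq_ij neq_ij].
wlog lt_ij : i j iN jN eq_ij neq_ij / (i < j)%N.
  by move=> W; case: (ltngtP i j) => // /W; apply => // /esym.
exists (j - i)%N; first lia.
have : coset j (a ^+ j) by exists 1; rewrite ?mulg1.
rewrite -eq_ij => -[h Hh]; rewrite -{1}(subnKC (ltnW lt_ij)) expgnDr.
by move=> /mulgI <-.
Qed.

End CommutatorTree.

(** * Word length of commutator trees *)

Section WordLength.
Local Open Scope group_scope.
Variables (G : groupType) (X : set G).

Definition length_le (g : G) (n : nat) : Prop :=
  exists2 k, (k <= n)%N & is_word_product X g k.

Lemma length_leW g m n : (m <= n)%N -> length_le g m -> length_le g n.
Proof. by move=> le_mn [k le_km gk]; exists k => //; apply: leq_trans le_mn. Qed.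

Lemma length_le1 : length_le 1 0.
Proof. by exists 0%N => //; exists [::]; rewrite big_nil. Qed.

Lemma length_leM g h m n :
  length_le g m -> length_le h n -> length_le (g * h) (m + n).
Proof.
move=> [k le_km [v [vk vX ->]]] [l le_ln [w [wl wX ->]]].
exists (k + l)%N; first lia.
exists (v ++ w); split; rewrite ?size_cat ?vk ?wl ?big_cat // => x.
by rewrite mem_cat => /orP[/vX|/wX].
Qed.

Lemma length_leV g n : length_le g n -> length_le g^-1 n.
Proof.
move=> [k le_kn [w [wk wX ->]]]; exists k => //.
exists (rev [seq x^-1 | x <- w]); split.
- by rewrite size_rev size_map.
- move=> x; rewrite mem_rev => /mapP[y /wX yX ->].
  by rewrite invgK; case: yX; [right | left].
elim: w {wk wX} => [|x w IH]; first by rewrite !big_nil invg1.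
by rewrite big_cons invgM IH /= rev_cons big_rcons.
Qed.

Lemma length_leX g m n : length_le g m -> length_le (g ^+ n) (n * m).
Proof.
move=> gm; elim: n => [|n IH]; first exact: length_le1.
by rewrite expgS mulSn; apply: length_leM.
Qed.

Lemma length_leJ g h m n :
  length_le g m -> length_le h n -> length_le (g ^ h) (m + n.*2).
Proof.
move=> gm hn; have := length_leM (length_leV hn) (length_leM gm hn).
by apply: length_leW; lia.
Qed.

Lemma length_leR g h m n :
  length_le g m -> length_le h n -> length_le [~ g, h] (m + n).*2.
Proof.
move=> gm hn; have := length_leM (length_leV gm) (length_leJ gm hn).
by apply: length_leW; lia.
Qed.

(** The elements of finite length form a subgroup containing [X]. *)
Lemma length_le_generates g : generates X -> exists n, length_le g n.
Proof.
move=> genX; change ([set g | exists n, length_le g n] g).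
rewrite (genX [set g | exists n, length_le g n]) //.
  split=> [|x y [m xm] [n yn]|x [n xn]].
  - by exists 0%N; apply: length_le1.
  - by exists (m + n)%N; apply: length_leM.
  - by exists n; apply: length_leV.
move=> x Xx; exists 1%N, 1%N => //; exists [:: x]; split=> //.
  by move=> y; rewrite inE => /eqP ->; left.
by rewrite big_seq1.
Qed.

(* The recursion [l' = 4 l + 6] has the fixed point [-2], hence the shift. *)
Lemma length_le_comm_tree a b L d s : length_le a L -> length_le b L ->
  length_le (comm_tree a b d s) (L * (4 ^ d * (s + 2 ^ d + 2) - 2)).
Proof.
move=> aL bL; elim: d s => [|d IH] s /=.
  by apply: length_leW (length_leX s.+1 aL); nia.
have := length_leJ
  (length_leR (IH s) (length_leJ (IH (s + 2 ^ d)%N) bL)) aL.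
apply: length_leW; rewrite !expnS.
have : (0 < 2 ^ d)%N by rewrite expn_gt0.
have : (0 < 4 ^ d)%N by rewrite expn_gt0.
move: (2 ^ d)%N (4 ^ d)%N => u v *.
nia.
Qed.

End WordLength.

(** * The group of bijections of a type *)

Section SelfBijections.
Local Open Scope group_scope.

(** The inverse is stored as data so that [alpha^-1 v] computes in the ping-pong lemmas. *)
Record self_bij (T : Type) := SelfBij {
  bij_fun :> T -> T;
  bij_inv : T -> T;
  bij_funK : cancel bij_fun bij_inv;
  bij_invK : cancel bij_inv bij_fun }.

Variable T : Type.
Implicit Types p q r : self_bij T.

HB.instance Definition _ := gen_eqMixin (self_bij T).
HB.instance Definition _ := gen_choiceMixin (self_bij T).

Lemma self_bijP p q : p =1 q -> p = q.
Proof.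
case: p q => [f f' fK f'K] [g g' gK g'K] /= /funext efg; subst g.
have efg' : f' = g' by apply/funext => x; rewrite -{1}(g'K x) fK.
by subst g'; congr SelfBij; exact: Prop_irrelevance.
Qed.

Definition self_bij_one : self_bij T := @SelfBij T id id (frefl _) (frefl _).
Definition self_bij_inv p := SelfBij (bij_invK p) (bij_funK p).
Definition self_bij_mul p q :=
  SelfBij (can_comp (bij_funK p) (bij_funK q))
          (can_comp (bij_invK q) (bij_invK p)).

Lemma self_bij_mulA : associative self_bij_mul.
Proof. by move=> p q r; apply: self_bijP. Qed.
Lemma self_bij_mul1 : left_id self_bij_one self_bij_mul.
Proof. by move=> p; apply: self_bijP. Qed.
Lemma self_bij_mulr1 : right_id self_bij_one self_bij_mul.
Proof. by move=> p; apply: self_bijP. Qed.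
Lemma self_bij_mulV : left_inverse self_bij_one self_bij_inv self_bij_mul.
Proof. by move=> p; apply: self_bijP => x /=; rewrite bij_funK. Qed.
Lemma self_bij_mulrV : right_inverse self_bij_one self_bij_inv self_bij_mul.
Proof. by move=> p; apply: self_bijP => x /=; rewrite bij_invK. Qed.

HB.instance Definition _ := isGroup.Build (self_bij T)
  self_bij_mulA self_bij_mul1 self_bij_mulr1 self_bij_mulV self_bij_mulrV.

Lemma self_bijM p q x : (p * q) x = p (q x). Proof. by []. Qed.

End SelfBijections.

(** * Ping-pong for two shears of the integer plane *)

Section PingPong.
Local Open Scope group_scope.

Definition shear_x (k : int) (v : int * int) : int * int :=
  (v.1 + k * v.2, v.2)%R.
Definition shear_y (k : int) (v : int * int) : int * int :=
  (v.1, v.2 + k * v.1)%R.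

Lemma shear_xK k : cancel (shear_x k) (shear_x (- k)).
Proof. by move=> [x y]; rewrite /shear_x /= mulNr addrK. Qed.
Lemma shear_xVK k : cancel (shear_x (- k)) (shear_x k).
Proof. by move=> [x y]; rewrite /shear_x /= mulNr addrNK. Qed.
Lemma shear_yK k : cancel (shear_y k) (shear_y (- k)).
Proof. by move=> [x y]; rewrite /shear_y /= mulNr addrK. Qed.
Lemma shear_yVK k : cancel (shear_y (- k)) (shear_y k).
Proof. by move=> [x y]; rewrite /shear_y /= mulNr addrNK. Qed.

(** [alpha] and [beta] are the matrices with rows (1 2), (0 1) and (1 0), (2 1). *)
Definition alpha : self_bij (int * int) := SelfBij (shear_xK 2) (shear_xVK 2).
Definition beta : self_bij (int * int) := SelfBij (shear_yK 2) (shear_yVK 2).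

Definition wide : set (int * int) := [set v | (`|v.2| < `|v.1|)%R].
Definition tall : set (int * int) := [set v | (`|v.1| < `|v.2|)%R].
(** [alpha] may send a wide vector such as (3, -2) to a tall one. The sign condition cuts out a part
    of [wide] stable under [alpha], and [wide_neg] one stable under [alpha^-1]. *)
Definition wide_pos : set (int * int) := [set v | wide v /\ (0 <= v.1 * v.2)%R].
Definition wide_neg : set (int * int) := [set v | wide v /\ (v.1 * v.2 <= 0)%R].

Lemma wide_posW v : wide_pos v -> wide v. Proof. by case. Qed.
Lemma wide_negW v : wide_neg v -> wide v. Proof. by case. Qed.

Lemma alpha_tall v : tall v -> wide_pos (alpha v).
Proof. by case: v => x y; rewrite /tall /wide_pos /wide /=; nia. Qed.
Lemma alpha_wide_pos v : wide_pos v -> wide_pos (alpha v).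
Proof. by case: v => x y; rewrite /wide_pos /wide /=; nia. Qed.
Lemma alphaV_tall v : tall v -> wide_neg (alpha^-1 v).
Proof. by case: v => x y; rewrite /tall /wide_neg /wide /=; nia. Qed.
Lemma alphaV_wide_neg v : wide_neg v -> wide_neg (alpha^-1 v).
Proof. by case: v => x y; rewrite /wide_neg /wide /=; nia. Qed.
Lemma beta_wide v : wide v -> tall (beta v).
Proof. by case: v => x y; rewrite /wide /tall /=; lia. Qed.
Lemma betaV_wide v : wide v -> tall (beta^-1 v).
Proof. by case: v => x y; rewrite /wide /tall /=; lia. Qed.

(* Semantic form of "reduced, and starting and ending with a power of alpha, the
last letter being alpha itself". *)
Definition alternating (p : self_bij (int * int)) : Prop :=
  [/\ forall v, tall v -> wide (p v),
      forall v, wide_pos v -> wide (p v)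
    & forall v, tall v -> wide_neg (p^-1 v)].

Lemma alternating_comm_tree d s : alternating (comm_tree alpha beta d s).
Proof.
elim: d s => [|d IH] s /=.
  have alphaX v : tall v \/ wide_pos v -> wide_pos ((alpha ^+ s.+1) v).
    move=> tv; elim: s => [|s IHs]; last by rewrite expgS; apply: alpha_wide_pos.
    by case: tv; [apply: alpha_tall | apply: alpha_wide_pos].
  split=> v tv; first by apply: wide_posW; apply: alphaX; left.
    by apply: wide_posW; apply: alphaX; right.
  elim: s {alphaX} => [|s IHs]; first exact: alphaV_tall.
  by rewrite expgSr invgM; apply: alphaV_wide_neg.
move: (comm_tree _ _ d s) (IH s) (comm_tree _ _ d _) (IH (s + 2 ^ d)%N).
move=> x [x_tall x_pos xV_tall] y [y_tall y_pos yV_tall].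
(* The word is [a^-1 x^-1 b^-1 y^-1 b x b^-1 y b a], acting from the right. Only [a^-1 x^-1] lacks a
   separating [b]; there [x^-1] lands in [wide_neg], which [a^-1] preserves. *)
have z_pos v : wide_pos (alpha v) -> wide (([~ x, y ^ beta] ^ alpha) v).
  rewrite /commg /conjg !invgM invgK -!mulgA !self_bijM => av.
  apply/wide_negW/alphaV_wide_neg/xV_tall/betaV_wide/wide_negW/yV_tall.
  apply/beta_wide/x_tall/betaV_wide/y_tall/beta_wide.
  exact: wide_posW.
split=> [v /alpha_tall/z_pos//|v /alpha_wide_pos/z_pos//|v tv].
(* In the inverse word the adjacent pair is [x a], which is what the [wide_pos] clause of
   [alternating] is for. *)
rewrite -conjVg invgR /commg /conjg !invgM invgK -!mulgA !self_bijM.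
apply/alphaV_tall/betaV_wide/wide_negW/yV_tall/beta_wide/wide_negW/xV_tall.
apply/betaV_wide/y_tall/beta_wide/x_pos.
exact: alpha_tall.
Qed.

Lemma comm_tree_neq1 d s : comm_tree alpha beta d s <> 1.
Proof.
move=> eq1; have [+ _ _] := alternating_comm_tree d s.
(* The vector (0, 1) is tall, and the identity does not make it wide. *)
by rewrite eq1 => /(_ (0, 1)%R isT).
Qed.

End PingPong.

(** * Transfer to nonabelian free groups *)

Section FreeGroup.
Local Open Scope group_scope.

Lemma hom_conj (G : groupType) (g : G) : is_group_hom (conjg^~ g).
Proof. by move=> x y; rewrite conjMg. Qed.

(* Conjugation fixing the basis is the identity, by uniqueness in the universal
property; apply this to basis elements first, then to arbitrary elements. *)
Lemma free_basis_abelian (G : groupType) (I : Type) (b : I -> G) :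
  free_basis b -> (forall i j, commute (b i) (b j)) -> is_abelian G.
Proof.
move=> freeb comm_b.
have conj_id g : (forall i, b i ^ g = b i) -> forall x, x ^ g = x.
  move=> bg x; have [f [_ _ f_uniq]] := freeb G b.
  by rewrite (f_uniq _ (hom_conj g) bg) -(f_uniq id).
have comm_conj (x y : G) : commute x y -> x ^ y = x.
  by move=> xy; rewrite /conjg xy mulKg.
have central j x : commute (b j) x.
  by apply/esym; rewrite (conjgC x) conj_id // => i; apply: comm_conj.
move=> x y; rewrite conjgC conj_id // => i; apply: comm_conj.
exact: central.
Qed.

(** Noncommutativity forces two distinct basis elements. Mapping them to [alpha] and [beta] and the
    rest of the basis to 1 carries each tree to a nontrivial one. *)
Lemma free_nonabelian_comm_tree (G : groupType) (m : nat) :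
  is_free_of_rank G m -> ~ is_abelian G ->
  exists a b : G, forall d s, comm_tree a b d s <> 1.
Proof.
move=> [b freeb] nabG.
have [i [j nij]] : exists i j : 'I_m, i != j.
  apply: contrapT => noij; apply: nabG; apply: (free_basis_abelian freeb).
  move=> i j; have [->|nij] := eqVneq i j; first exact: commute_refl.
  by case: noij; exists i, j.
pose phi k := if k == i then alpha else if k == j then beta else 1.
have [f [fM fb _]] := freeb _ phi.
exists (b i), (b j) => d s eq1; apply: (@comm_tree_neq1 d s).
have -> : alpha = f (b i) by rewrite fb /phi eqxx.
have -> : beta = f (b j) by rewrite fb /phi eqxx eq_sym (negPf nij).
by rewrite -hom_comm_tree // eq1 hom1.
Qed.

End FreeGroup.

(** * The lower bound on residual growth *)

Lemma least_le (R : realType) (P : nat -> Prop) k :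
  P k -> (least R P <= k%:R%:E)%E.
Proof.
move=> Pk; rewrite /least; case: pselect => [exP|[]]; last by exists k; apply/asboolP.
by case: ex_minnP => n _ n_min; rewrite lee_fin ler_nat; apply/n_min/asboolP.
Qed.

Theorem proposition4p3 (R : realType) (Gamma : groupType) (m : nat)
    (X : set Gamma) :
  is_free_of_rank Gamma m ->
  ~ is_abelian Gamma ->
  finite_set X ->
  generates X ->
  preceq (fun n : nat => (n%:R `^ (3%:R)^-1)%:E) (@residual_growth R Gamma X).
Proof.
move=> freeG nabG _ genX.
have [a [b ab_neq1]] := free_nonabelian_comm_tree freeG nabG.
have [La aLa] := length_le_generates a genX.
have [Lb bLb] := length_le_generates b genX.
(* [C] must exceed both the length factor [L] and the 24 in the bound [24 * N ^ 3] below; the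
   successor keeps it positive. *)
pose L := (La + Lb)%N; pose C := (24 * L.+1)%N.
have aL : length_le X a L := length_leW (leq_addr _ _) aLa.
have bL : length_le X b L := length_leW (leq_addl _ _) bLb.
exists C; split=> // n n_gt0; rewrite /residual_growth /least.
(* If no [N] qualifies, the right-hand side is [+oo]. *)
case: pselect => [exP|_]; last by rewrite gt0_muley ?leey // lte_fin ltr0n.
case: ex_minnP => N /asboolP[N_gt0 sepN] _.
rewrite -EFinM lee_fin -natrM.
suff le_n : (n <= (C * N) ^ 3)%N.
  rewrite (le_trans (ge0_ler_powR _ _ _ (_ : _ <= ((C * N) ^ 3)%:R))) ?nnegrE //.
    by rewrite ler_nat.
  by rewrite natrX -powR_mulrn // -powRrM divff // powRr1.
rewrite leqNgt; apply/negP => lt_n.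
have [d le_Nd le_d2N] : exists2 d, (N <= 2 ^ d)%N & (2 ^ d <= 2 * N)%N.
  exists (up_log 2 N); first exact: up_logP.
  have [N1|N_gt1] := leqP N 1; first by have -> : N = 1%N by lia.
  have /andP[+ _] := up_log_bounds (isT : 1 < 2)%N N_gt1.
  have : (0 < up_log 2 N)%N by rewrite up_log_gt0.
  by case: (up_log 2 N) => // e _; rewrite /= expnS; lia.
have len_w : length_le X (comm_tree a b d 0) (C * n).
  apply: length_leW (length_le_comm_tree d 0 aL bL).
  have -> : (4 ^ d = (2 ^ d) ^ 2)%N by rewrite -expnM mulnC expnM.
  (* With [u = 2 ^ d], [u ^ 2 * (u + 2) <= 3 * u ^ 3 <= 3 * (2 * N) ^ 3]. *)
  have le_u : ((2 ^ d) ^ 2 * (0 + 2 ^ d + 2) <= 24 * N ^ 3)%N.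
    have : (0 < 2 ^ d)%N by rewrite expn_gt0.
    have : ((2 ^ d) ^ 3 <= (2 * N) ^ 3)%N by rewrite leq_exp2r.
    by rewrite expnMn; move: (2 ^ d)%N => u; nia.
  have le_N : (24 * N ^ 3 <= (C * N) ^ 3)%N.
    rewrite expnMn leq_mul2r (leq_trans (_ : 24 <= C)%N) ?orbT //.
      by rewrite /C; lia.
    by rewrite -{1}(expn1 C) leq_pexp2l.
  apply: leq_mul; first by rewrite /C; lia.
  apply: leq_trans (leq_subr _ _) (leq_trans le_u (leq_trans le_N _)).
  exact: ltnW.
have [k le_k wk] := len_w.
have [|H [nH HN]] := sepN _ (ab_neq1 d 0%N).
  by apply: le_trans (least_le R wk) _; rewrite lee_fin ler_nat.
(* Since [i <= N <= 2 ^ d], the power in [H] is a leaf of the tree, so the tree lies in [H], a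
   contradiction. *)
case; have [i /andP[i_gt0 le_iN] Hi] := index_le_pow a nH.1 HN.
by apply: comm_tree_normal nH _ Hi; lia.
Qed.
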